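(* Let $a<b$ be two consecutive $k$-layered numbers. Then: if $k=2$, $b-a\le 12$; if $k=3$, $b-a\le 360$; if $k=4$, $b-a\le 194040$; if $k=5$, $b-a\le 1911349440$.
   Context: For a positive integer $k$, a positive integer $n$ is $k$-layered if the set of all positive divisors of $n$ can be partitioned into $k$ subsets having the same sum of elements. Two $k$-layered numbers $a<b$ are consecutive if no integer strictly between $a$ and $b$ is $k$-layered. *)

(* Defs.v *)
From mathcomp Require Import all_boot.

Set Implicit Arguments.
Unset Strict Implicit.
Unset Printing Implicit Defensive.

Definition divisor_set (n : nat) : {set 'I_n.+1} := [set d : 'I_n.+1 | d %| n].

(* [partition] asks for nonempty blocks; this costs nothing, since a block of
   sum 0 would force every block to have sum 0, whereas 1 divides n. *)
Definition layered (k n : nat) : Prop :=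
  0 < n /\
  exists P : {set {set 'I_n.+1}},
    [/\ partition P (divisor_set n),
        #|P| = k
      & {in P &, forall A B : {set 'I_n.+1},
          \sum_(d in A) (d : nat) = \sum_(d in B) (d : nat)}].

Definition consecutive_layered (k a b : nat) : Prop :=
  [/\ a < b, layered k a, layered k b
    & forall n : nat, a < n < b -> ~ layered k n].

(* Main.v *)
Require Import Defs.
From Stdlib Require Import BinNat.
From mathcomp Require Import all_boot.

Set Implicit Arguments.
Unset Strict Implicit.
Unset Printing Implicit Defensive.

(* If N is k-layered and t is coprime to N, each divisor of t scales the
   partition of the divisors of N, so N * t is k-layered. Take N = 2^a0 * m with
   m odd: N = 6, 120, 27720, 147026880 for k = 2, 3, 4, 5. The powers of 2 in t
   are harmless: the partitions for 2^a * m with a0 <= a <= 2 * a0 are found by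
   first-fit, and stacking that of 2^a0 * m with a scaled copy of that of
   2^b * m gives 2^(a0 + b + 1) * m. Hence N * t is k-layered as soon as t is
   coprime to m, and any L = 2, 3, 7, 13 consecutive integers contain such a t
   (L is half the Jacobsthal function of 2 * m); the gaps are at most L * N. *)

(** * Balanced lists and layered numbers *)

Definition loads_to (z : seq (nat * nat)) (i : nat) : nat :=
  \sum_(p <- z | p.1 == i) p.2.

(* [z] lists the elements of [s], each tagged with the index of its part. *)
Definition balanced (k : nat) (s : seq nat) : Prop :=
  exists T, exists z : seq (nat * nat),
    [/\ perm_eq (unzip2 z) s, all (fun p => p.1 < k) z
      & forall i, i < k -> loads_to z i = T].

Lemma balanced_perm k s t : perm_eq s t -> balanced k s -> balanced k t.
Proof.
by move=> est [T [z [ezs zk zT]]]; exists T, z; split=> //; apply: perm_trans est.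
Qed.

Lemma balanced_nil k : balanced k [::].
Proof. by exists 0, [::]; split=> // i _; rewrite /loads_to big_nil. Qed.

Lemma balanced_cat k s t : balanced k s -> balanced k t -> balanced k (s ++ t).
Proof.
move=> [T [z [ezs zk zT]]] [U [w [ewt wk wU]]]; exists (T + U), (z ++ w).
split=> [||i ik]; first by rewrite /unzip2 map_cat perm_cat.
  by rewrite all_cat zk.
by rewrite /loads_to big_cat /= -!/(loads_to _ _) zT ?wU.
Qed.

Lemma balanced_scale k c s : balanced k s -> balanced k [seq c * x | x <- s].
Proof.
move=> [T [z [ezs zk zT]]]; exists (c * T), [seq (p.1, c * p.2) | p <- z].
split=> [||i ik]; last 1 first.
- by rewrite /loads_to big_map -big_distrr -(zT i ik).
- by rewrite /unzip2 -map_comp (map_comp (muln c) snd) perm_map.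
- by rewrite all_map.
Qed.

Lemma balanced_mul k s t :
  balanced k t -> balanced k [seq x * y | x <- s, y <- t].
Proof.
move=> kt; elim: s => [|x s IHs]; first exact: balanced_nil.
by rewrite allpairs_cons; apply: balanced_cat => //; apply: balanced_scale.
Qed.

(** The blocks are the fibres of the tag: disjoint because divisors are listed without repetition,
    nonempty because the common sum is positive. *)
Lemma balanced_layered k n :
  0 < k -> 0 < n -> balanced k (divisors n) -> layered k n.
Proof.
move=> k_gt0 n_gt0 [T [z [ezn zk zT]]]; split=> //.
pose B (i : 'I_k) := [set d : 'I_n.+1 | (val i, val d) \in z].
have zU : uniq (unzip2 z) by rewrite (perm_uniq ezn) divisors_uniq.
have z_inj i j d : (i, d) \in z -> (j, d) \in z -> i = j.
  move=> zi zj; apply/eqP; apply: contraTT zU => neq_ij.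
  apply/negP; elim: z zi zj {ezn zk zT B} => // -[h e] z IHz.
  rewrite !in_cons => /predU1P[[ih de]|zi] /predU1P[[jh de']|zj] /andP[/= he zU].
  - by rewrite ih jh eqxx in neq_ij.
  - by case/negP: he; apply/mapP; exists (j, d).
  - by case/negP: he; apply/mapP; exists (i, d).
  - exact: IHz.
have sumB i : \sum_(d in B i) (d : nat) = T.
  rewrite -(zT i) // /loads_to.
  have -> : \sum_(p <- z | p.1 == val i) p.2 =
            \sum_(d <- [seq p.2 | p <- z & p.1 == val i]) d.
    by rewrite big_map big_filter.
  have -> : \sum_(d in B i) (d : nat) = \sum_(d <- [seq val d | d in B i]) d.
    by rewrite big_map big_enum.
  apply: perm_big; apply: uniq_perm.
  - by rewrite (map_inj_uniq val_inj) enum_uniq.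
  - by apply: subseq_uniq zU; apply/map_subseq/filter_subseq.
  move=> d; apply/mapP/mapP => [[e]|[[j e]]].
    by rewrite mem_enum inE => ez ->; exists (val i, val e); rewrite ?mem_filter ?eqxx.
  rewrite mem_filter => /andP[/= /eqP -> iez] ->.
  have : e \in divisors n by rewrite -(perm_mem ezn); apply/mapP; exists (val i, e).
  rewrite -dvdn_divisors // => /(dvdn_leq n_gt0); rewrite -ltnS => e_lt.
  by exists (Ordinal e_lt); rewrite ?mem_enum ?inE.
(* The part that receives the divisor 1 already has a positive sum. *)
have T_gt0 : 0 < T.
  have : 1 \in unzip2 z by rewrite (perm_mem ezn) divisor1.
  case/mapP=> -[i e] iz /= e1; rewrite -(zT i); last by have /allP/(_ _ iz) := zk.
  by rewrite /loads_to (big_rem _ iz) /= eqxx -e1.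
have [||P_part B_inj] := @indexed_partition _ _ [set: 'I_k] B.
- move=> i j _ _ /eqP neq_ji; apply/pred0P=> d /=; apply/negbTE/negP.
  by rewrite !inE => /andP[iz jz]; apply/neq_ji/val_inj/(z_inj _ _ _ jz iz).
- move=> i _; apply: contraTneq T_gt0 => B0; rewrite -(sumB i) B0 big_set0 //.
exists [set B i | i in [set: 'I_k]]; split; first 1 last.
- by rewrite card_in_imset // cardsT card_ord.
- by move=> C D /imsetP[i _ ->] /imsetP[j _ ->]; rewrite !sumB.
suff <- : cover [set B i | i in [set: 'I_k]] = divisor_set n by [].
apply/setP=> d; rewrite inE dvdn_divisors // -(perm_mem ezn) cover_imset.
apply/bigcupP/mapP => [[i _]|[[i e] iz /= de]].
  by rewrite inE => dz; exists (val i, val d).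
have ik : i < k by have /allP/(_ _ iz) := zk.
by exists (Ordinal ik); rewrite ?inE //= de.
Qed.

(** * Divisors of coprime products and of prime powers *)

(** A divisor [d] of [m * n] factors uniquely as [gcdn m d * gcdn n d]. *)
Lemma perm_divisorsM m n : 0 < m -> 0 < n -> coprime m n ->
  perm_eq (divisors (m * n)) [seq x * y | x <- divisors m, y <- divisors n].
Proof.
move=> m_gt0 n_gt0 co_mn.
have gcdl x y : x %| m -> y %| n -> gcdn m (x * y) = x.
  move=> xm yn; rewrite Gauss_gcdl; first exact/gcdn_idPr.
  exact: coprime_dvdr co_mn.
have gcdr x y : x %| m -> y %| n -> gcdn n (x * y) = y.
  move=> xm yn; rewrite Gauss_gcdr; first exact/gcdn_idPr.
  by rewrite coprime_sym; apply: coprime_dvdl co_mn.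
apply: uniq_perm; first exact: divisors_uniq.
  apply: allpairs_uniq; rewrite ?divisors_uniq // => -[x y] [x' y'].
  move=> /allpairsP[p [+ + [-> ->]]] /allpairsP[q [+ + [-> ->]]] /=.
  rewrite -!dvdn_divisors // => px py qx qy e.
  by congr (_, _); [rewrite -(gcdl p.1 p.2) // e gcdl |
                    rewrite -(gcdr p.1 p.2) // e gcdr].
move=> d; rewrite -dvdn_divisors ?muln_gt0 ?m_gt0 //.
apply/idP/allpairsP => [d_mn|[[x y] /= []]]; last first.
  by rewrite -!dvdn_divisors // => xm yn ->; apply: dvdn_mul.
exists (gcdn m d, gcdn n d); rewrite /= -!dvdn_divisors ?dvdn_gcdl //; split=> //.
apply/eqP; rewrite eqn_dvd Gauss_dvd ?dvdn_gcdr ?andbT; last first.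
  by apply: coprime_dvdl (dvdn_gcdl _ _) _; apply: coprime_dvdr (dvdn_gcdl _ _) _.
by rewrite muln_gcdl dvdn_gcd muln_gcdr dvdn_gcd d_mn dvdn_mull ?dvdn_mulr.
Qed.

Lemma perm_divisorsX p a : prime p ->
  perm_eq (divisors (p ^ a)) [seq p ^ i | i <- iota 0 a.+1].
Proof.
move=> p_pr; apply: uniq_perm; rewrite ?divisors_uniq //.
  by rewrite map_inj_uniq ?iota_uniq //; apply/expnI/prime_gt1.
move=> d; rewrite -dvdn_divisors ?expn_gt0 ?prime_gt0 //.
apply/(dvdn_pfactor _ _ p_pr)/mapP => -[i ia ->]; exists i => //.
  by rewrite mem_iota.
by rewrite mem_iota in ia.
Qed.

Lemma balanced_divisorsM k m n : 0 < m -> 0 < n -> coprime m n ->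
  balanced k (divisors n) -> balanced k (divisors (m * n)).
Proof.
move=> m_gt0 n_gt0 co_mn kn.
by apply: balanced_perm (balanced_mul (divisors m) kn); rewrite perm_sym perm_divisorsM.
Qed.

(* The divisors of [p ^ (a + b).+1 * m] are those of [p ^ a * m] together with
   the [p ^ a.+1]-multiples of those of [p ^ b * m]. *)
Lemma balanced_divisorsX k p m a b : prime p -> 0 < m -> coprime p m ->
    balanced k (divisors (p ^ a * m)) -> balanced k (divisors (p ^ b * m)) ->
  balanced k (divisors (p ^ (a + b).+1 * m)).
Proof.
move=> p_pr m_gt0 co_pm ka kb.
have E c : perm_eq (divisors (p ^ c * m))
    [seq x * y | x <- [seq p ^ i | i <- iota 0 c.+1], y <- divisors m].
  apply: perm_trans (perm_divisorsM _ _ _) _ => //.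
  - by rewrite expn_gt0 prime_gt0.
  - exact: coprimeXl.
  - by apply: perm_allpairs; rewrite ?perm_divisorsX.
apply: balanced_perm (balanced_cat ka (balanced_scale (p ^ a.+1) kb)).
rewrite perm_sym; apply: perm_trans (E _) _.
(* The exponents [0..a+b+1] split into [0..a] and [a+1..a+b+1]. *)
rewrite -addnS -addSn iotaD map_cat allpairs_cat.
apply: perm_cat; first by rewrite perm_sym E.
rewrite perm_sym; apply: perm_trans (perm_map _ (E b)) _.
rewrite map_allpairs !allpairs_mapl add0n.
rewrite -[in iota a.+1 _](addn0 a.+1) iotaDl allpairs_mapl.
have -> // : [seq p ^ a.+1 * (p ^ x * y) | x <- iota 0 b.+1, y <- divisors m]
           = [seq p ^ (a.+1 + x) * y | x <- iota 0 b.+1, y <- divisors m].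
by apply: eq_allpairs => x y; rewrite expnD mulnA.
Qed.

Lemma balanced_divisors_2exp k m a0 : odd m ->
    (forall a, a0 <= a <= a0.*2 -> balanced k (divisors (2 ^ a * m))) ->
  forall a, a0 <= a -> balanced k (divisors (2 ^ a * m)).
Proof.
move=> m_odd kbase; elim/ltn_ind=> a IHa a_ge.
have [a_le|a_gt] := leqP a a0.*2; first by apply: kbase; rewrite a_ge.
have lt2a : a0.+1 + a0 <= a by rewrite addSn addnn.
(* Past [a0.*2], the exponent [a - a0.+1] is still at least [a0], so the induction hypothesis covers
   it. *)
have -> : a = (a0 + (a - a0.+1)).+1.
  by rewrite -addSn subnKC // (leq_trans _ lt2a) ?leq_addr.
apply: balanced_divisorsX; rewrite ?coprime2n ?odd_gt0 //.
  by apply: kbase; rewrite leqnn -addnn leq_addr.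
apply: IHa; first by rewrite ltn_subrL (leq_trans _ a_gt).
by rewrite leq_subRL // (leq_trans _ lt2a) ?leq_addr.
Qed.

Lemma layered_multiple k m a0 t : 0 < k -> odd m -> 0 < t -> coprime m t ->
    (forall a, a0 <= a <= a0.*2 -> balanced k (divisors (2 ^ a * m))) ->
  layered k (2 ^ a0 * m * t).
Proof.
move=> k_gt0 m_odd t_gt0 co_mt kbase.
have m_gt0 := odd_gt0 m_odd.
(* The 2-part of [t] is absorbed into the power of 2; its odd part is coprime to everything else. *)
have -> : 2 ^ a0 * m * t = t`_2^' * (2 ^ (a0 + logn 2 t) * m).
  rewrite -{1}(partnC 2 t_gt0) p_part expnD [RHS]mulnC -!mulnA.
  by congr (_ * _); rewrite mulnCA.
have h_gt0 : 0 < 2 ^ (a0 + logn 2 t) * m by rewrite muln_gt0 expn_gt0 m_gt0.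
apply: balanced_layered => //; first by rewrite muln_gt0 part_gt0.
apply: balanced_divisorsM => //; last first.
  by apply: balanced_divisors_2exp kbase _ _; rewrite ?leq_addr.
rewrite coprimeMr; apply/andP; split; last first.
  by rewrite coprime_sym; apply: coprime_dvdr co_mt; apply: dvdn_part.
rewrite coprimeXr // coprime_sym coprime2n -[odd _]negbK -dvdn2.
by rewrite -p'natE // part_pnat.
Qed.

(** * Integers coprime to given primes in short intervals *)

(* Decides, by depth-first search, whether each [x \in s] can be assigned a
   prime in [ps] so that elements sharing a prime [p] agree modulo [p]: the
   first uncovered element needs some [p], which then covers its class. *)
Fixpoint coverable_rec (fuel : nat) (ps s : seq nat) : bool :=
  if s is x :: s' then
    if fuel is fuel'.+1 then
      has (fun p => coverable_rec fuel' (rem p ps)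
                      [seq y <- s' | y != x %[mod p]]) ps
    else false
  else true.

(** Each level of the search uses up one element of [ps], so [size ps] is enough fuel. *)
Definition coverable ps s := coverable_rec (size ps) ps s.

(** By contraposition: if each [x + j] had a divisor in [ps], choosing these divisors would make the
    search succeed. The test does not mention [x], so one computation serves all translates. *)
Lemma uncoverable_coprime ps s x : ~~ coverable ps s ->
  exists2 j, j \in s & all (fun p => ~~ (p %| x + j)) ps.
Proof.
move=> nc; suff /allPn[j js njs] : ~~ all (fun j => has (dvdn ^~ (x + j)) ps) s.
  by exists j; rewrite // all_predC.
apply: contra nc; rewrite /coverable; move En: (size ps) => n.
elim: n ps s En => [|n IHn] ps [|y s] //= En.
  by rewrite (size0nil En).
case/andP=> /hasP[p pps py] /allP sP; apply/hasP; exists p => //.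
apply: IHn; first by rewrite size_rem // En.
apply/allP=> z; rewrite mem_filter => /andP[nzy zs].
have /hasP[q qps qz] := sP z zs; apply/hasP; exists q => //.
(* If [p] divided both [x + y] and [x + z], then [z] would agree with [y] modulo [p] and would have
   been filtered out. *)
apply: rem_mem => //; apply: contraNneq nzy => eqp; rewrite -(eqn_modDl x) -eqp.
by move: qz; rewrite eqp; move: py; rewrite /dvdn => /eqP-> /eqP->.
Qed.

(** * First-fit partitioning in binary arithmetic *)

Lemma nat_of_binD (x y : N) : N.add x y = x + y :> nat.
Proof. by case: x y => [|x] [|y]; rewrite ?addn0 //= nat_of_add_pos. Qed.

Lemma nat_of_binM (x y : N) : N.mul x y = x * y :> nat.
Proof. by case: x y => [|x] [|y]; rewrite ?muln0 //= nat_of_mul_pos. Qed.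

Fixpoint place (x : N) (r : seq N) : option (seq N) :=
  if r is y :: r' then
    if N.leb x y then Some (N.sub y x :: r') else omap (cons y) (place x r')
  else None.

(* Each number goes into the first bin with enough remaining capacity; the test
   succeeds when every bin is filled exactly. *)
Fixpoint first_fit (s r : seq N) : bool :=
  if s is x :: s' then
    if place x r is Some r' then first_fit s' r' else false
  else all (pred1 N0) r.

Lemma place_nth x r r' : place x r = Some r' ->
  exists2 j, j < size r &
    size r' = size r /\
    forall i, nth N0 r i = nth N0 r' i + (if j == i then nat_of_bin x else 0) :> nat.
Proof.
elim: r r' => //= y r IHr r'; case: ifP => [le_xy [<-]|_].
  exists 0 => //; split=> // -[|i] /=; last by rewrite addn0.
  by rewrite -nat_of_binD N.sub_add //; apply/N.leb_le.
case: (place x r) IHr => //= r1 /(_ _ erefl)[j jr [szr IHr]] [<-].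
by exists j.+1; rewrite //= szr; split=> // -[|i] /=; rewrite ?addn0 ?IHr.
Qed.

(** Each placement lowers one capacity by the number placed; as all capacities end at 0, the loads
    equal the initial capacities. *)
Lemma first_fitP s r : first_fit s r ->
  exists z, [/\ unzip2 z = map nat_of_bin s, all (fun p => p.1 < size r) z
    & forall i, loads_to z i = nth N0 r i].
Proof.
elim: s r => [|x s IHs] r /=.
  move=> /all_pred1P r0; exists [::]; split=> // i.
  by rewrite /loads_to big_nil r0 nth_nseq if_same.
case Er': (place x r) => [r'|] // /IHs[z [<- zk zr]].
have [j jr [szr rE]] := place_nth Er'.
exists ((j, nat_of_bin x) :: z); split=> [||i] //=; first by rewrite jr -szr.
by rewrite rE -zr /loads_to big_cons /=; case: (j == i); rewrite ?addn0 // addnC.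
Qed.

(** First-fit decreasing: the largest numbers go first, into [k] bins of capacity one [k]-th of the
    total. *)
Definition splits (k : nat) (s : seq N) : bool :=
  first_fit (sort (fun x y => N.leb y x) s)
            (nseq k (N.div (foldr N.add N0 s) (bin_of_nat k))).

Lemma splits_balanced k s : splits k s -> balanced k (map nat_of_bin s).
Proof.
case/first_fitP=> z [zs]; rewrite size_nseq => zk zT.
eexists; exists z; split=> // [|i ik]; last by rewrite zT nth_nseq ik.
by rewrite zs perm_map // perm_sort.
Qed.

(** * Divisors computed from a prime factorization *)

Definition expN (p a : nat) : N := iter a (N.mul (bin_of_nat p)) 1%num.

Lemma nat_of_expN p a : expN p a = p ^ a :> nat.
Proof. by elim: a => //= a IHa; rewrite nat_of_binM IHa bin_of_natK expnS. Qed.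

Definition prodN (f : seq (nat * nat)) : N :=
  foldr (fun q x => N.mul (expN q.1 q.2) x) 1%num f.

Definition divisorsN (f : seq (nat * nat)) : seq N :=
  foldr (fun q s =>
           [seq N.mul x y | x <- [seq expN q.1 i | i <- iota 0 q.2.+1], y <- s])
        [:: 1%num] f.

Lemma prodN_gt0 f : all prime (unzip1 f) -> 0 < prodN f.
Proof.
elim: f => //= q f IHf /andP[q_pr /IHf f_gt0].
by rewrite nat_of_binM nat_of_expN muln_gt0 expn_gt0 prime_gt0.
Qed.

Lemma coprime_prodN f m : all (coprime m) (unzip1 f) -> coprime m (prodN f).
Proof.
elim: f => [|q f IHf] /=; first by rewrite coprimen1.
case/andP=> co_mq /IHf co_mf.
by rewrite nat_of_binM nat_of_expN coprimeMr co_mf coprimeXr.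
Qed.

Lemma coprime_prodN_prime p f : prime p -> all prime (unzip1 f) ->
  p \notin unzip1 f -> coprime p (prodN f).
Proof.
move=> p_pr /allP f_pr pf; apply: coprime_prodN; apply/allP=> q qf.
have q_pr := f_pr q qf; rewrite prime_coprime // dvdn_prime2 //.
by apply: contraNneq pf => ->.
Qed.

Lemma perm_divisorsN f : all prime (unzip1 f) -> uniq (unzip1 f) ->
  perm_eq (divisors (prodN f)) (map nat_of_bin (divisorsN f)).
Proof.
elim: f => // q f IHf /andP[q_pr f_pr] /andP[qf uf].
rewrite -[prodN _]/(N.mul (expN q.1 q.2) (prodN f)) -[divisorsN _]/(allpairs N.mul
  [seq expN q.1 i | i <- iota 0 q.2.+1] (divisorsN f)) nat_of_binM nat_of_expN.
apply: perm_trans (perm_divisorsM _ _ _) _.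
- by rewrite expn_gt0 prime_gt0.
- exact: prodN_gt0.
- by rewrite coprimeXl // coprime_prodN_prime.
rewrite map_allpairs allpairs_mapl.
apply: perm_trans (perm_allpairs _ (perm_divisorsX _ q_pr) (IHf f_pr uf)) _.
rewrite allpairs_mapl allpairs_mapr.
have -> // : [seq q.1 ^ i * nat_of_bin y | i <- iota 0 q.2.+1, y <- divisorsN f]
  = [seq nat_of_bin (N.mul (expN q.1 i) y) | i <- iota 0 q.2.+1, y <- divisorsN f].
by apply: eq_allpairs => i y; rewrite nat_of_binM nat_of_expN.
Qed.

(** * Certified gap bounds *)

(** Here [f] factors the odd part [m], and [iota a0 a0.+1] is the range [a0..2 * a0] of base
    exponents. *)
Definition gap_certificate (k a0 : nat) (f : seq (nat * nat)) (L : nat) : bool :=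
  [&& 0 < k, all prime (unzip1 ((2, a0) :: f)), uniq (unzip1 ((2, a0) :: f)),
      ~~ coverable (unzip1 f) (iota 0 L)
    & all (fun a => splits k (divisorsN ((2, a) :: f))) (iota a0 a0.+1)].

(** The first [L] multiples of [N] beyond [a] are at most [a + L * N]. One of them has its cofactor
    coprime to [m], hence is layered; a larger gap would contain it strictly inside. *)
Lemma gap_bound k a0 f L a b : gap_certificate k a0 f L ->
  consecutive_layered k a b ->
  b - a <= N.mul (bin_of_nat L) (prodN ((2, a0) :: f)).
Proof.
case/and5P=> k_gt0 /andP[_ f_pr] /andP[f2 uf] nc /allP kbase [lt_ab _ _ no_ab].
have m_gt0 := prodN_gt0 f_pr.
have m_odd : odd (prodN f) by rewrite -coprime2n coprime_prodN_prime.
rewrite nat_of_binM bin_of_natK nat_of_binM nat_of_expN.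
set N := 2 ^ a0 * prodN f; have N_gt0 : 0 < N by rewrite muln_gt0 expn_gt0.
rewrite leqNgt; apply/negP => lt_gap.
(* [N * q] is the least multiple of [N] exceeding [a]. *)
pose q := (a %/ N).+1.
have [j] := uncoverable_coprime q nc; rewrite mem_iota /= add0n => lt_jL co_j.
apply: (no_ab (N * (q + j))).
  apply/andP; split.
    apply: leq_trans (_ : q * N <= _); first by rewrite ltn_ceil.
    by rewrite mulnC leq_mul2l leq_addr orbT.
  have le_qa : a %/ N * N <= a by exact: leq_divM.
  have : N * (q + j) <= a + L * N.
    rewrite addSnnS mulnDr (mulnC N) leq_add // mulnC leq_mul2r lt_jL orbT //.
  by move/leq_ltn_trans; apply; rewrite -ltn_subRL.
apply: layered_multiple => //.
  rewrite coprime_sym; apply: coprime_prodN; apply/allP=> p pf.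
  by rewrite coprime_sym prime_coprime ?(allP f_pr) ?(allP co_j).
move=> c /andP[c_ge c_le].
have /splits_balanced : splits k (divisorsN ((2, c) :: f)).
  by apply: kbase; rewrite mem_iota c_ge addnS addnn ltnS.
apply: balanced_perm; rewrite -(nat_of_expN 2) -nat_of_binM.
by rewrite perm_sym; apply: (@perm_divisorsN ((2, c) :: f)) => //=; rewrite f2.
Qed.

(* %num: binary literals, read in nat through the coercion nat_of_bin *)
Theorem mainTheorem13 (k a b : nat) (hab : consecutive_layered k a b) :
  [/\ k = 2 -> b - a <= 12,
      k = 3 -> b - a <= 360,
      k = 4 -> b - a <= 194040%num
    & k = 5 -> b - a <= 1911349440%num].
Proof.
split=> Dk; rewrite {}Dk in hab.
(* The bounds are [L * N]: [2 * 6], [3 * 120], [7 * 27720] and [13 * 147026880]. *)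
- have cert : gap_certificate 2 1 [:: (3, 1)] 2 by vm_compute.
  exact: gap_bound cert hab.
- have cert : gap_certificate 3 3 [:: (3, 1); (5, 1)] 3 by vm_compute.
  exact: gap_bound cert hab.
- have cert : gap_certificate 4 3 [:: (3, 2); (5, 1); (7, 1); (11, 1)] 7.
    by vm_compute.
  exact: gap_bound cert hab.
- have cert : gap_certificate 5 6
      [:: (3, 3); (5, 1); (7, 1); (11, 1); (13, 1); (17, 1)] 13.
    by vm_compute.
  exact: gap_bound cert hab.
Qed.
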